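(* Let $u_l,u_r\in\mathbb{R}$ and $\rho_l,\rho_r>0$ with $u_l>u_r$. Then there exists $\eta>0$ such that for every $0<\epsilon<\eta$ there is a unique intermediate state $(u^*_\epsilon,\rho^*_\epsilon)$ such that $(u_l,\rho_l)$ (on the left) is connected to $(u^*_\epsilon,\rho^*_\epsilon)$ (on the right) by a 1-shock, and $(u^*_\epsilon,\rho^*_\epsilon)$ (on the left) is connected to $(u_r,\rho_r)$ (on the right) by a 2-shock, both shocks satisfying the Lax entropy condition, for the system $$u_t+\Big(\frac{u^2}{2}+\epsilon p(\rho)\Big)_x=0,\qquad \rho_t+(\rho u)_x=0 .$$
   Context: Here $p(\rho)=\int_0^\rho \frac{q'(\xi)}{\xi}\,d\xi$ with $q(\rho)=\int_0^\rho \xi^2 e^{\xi}\,d\xi$, i.e. $p(\rho)=\int_0^\rho \xi e^{\xi}\,d\xi$, and $\epsilon>0$ is a parameter. States are pairs $(u,\rho)$ with $\rho>0$. The eigenvalues of the system are $\lambda_1(u,\rho)=u-\sqrt{\epsilon p'(\rho)\rho}$ and $\lambda_2(u,\rho)=u+\sqrt{\epsilon p'(\rho)\rho}$. A left state $(\bar u,\bar\rho)$ is connected to a different right state $(u,\rho)$ by a shock of speed $s\in\mathbb{R}$ if the Rankine-Hugoniot conditions hold: $$s(u-\bar u)=\Big(\frac{u^2}{2}+\epsilon p(\rho)\Big)-\Big(\frac{\bar u^2}{2}+\epsilon p(\bar\rho)\Big),\qquad s(\rho-\bar\rho)=\rho u-\bar\rho\bar u .$$ It is a 1-shock satisfying the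 Lax entropy condition if $s<\lambda_1(\bar u,\bar\rho)$ and $\lambda_1(u,\rho)<s<\lambda_2(u,\rho)$. It is a 2-shock satisfying the Lax entropy condition if $s>\lambda_2(u,\rho)$ and $\lambda_1(\bar u,\bar\rho)<s<\lambda_2(\bar u,\bar\rho)$. *)

(* Defs.v *)
From Stdlib Require Import Reals.
From Coquelicot Require Import Coquelicot.
Open Scope R_scope.

Definition q (rho : R) : R := RInt (fun xi => xi ^ 2 * exp xi) 0 rho.

(* At [xi = 0] the integrand is [0 * / 0 = 0], which agrees with its continuous
   extension [xi * exp xi]. *)
Definition p (rho : R) : R := RInt (fun xi => Derive q xi / xi) 0 rho.

(* A pair [(u, rho)]; positivity of [rho] is imposed by [admissible]. *)
Definition state : Type := (R * R)%type.

Definition admissible (U : state) : Prop := 0 < snd U.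

Definition flux_u (eps : R) (U : state) : R :=
  let (u, rho) := U in u ^ 2 / 2 + eps * p rho.

Definition flux_rho (U : state) : R :=
  let (u, rho) := U in rho * u.

Definition lambda1 (eps : R) (U : state) : R :=
  let (u, rho) := U in u - sqrt (eps * Derive p rho * rho).

Definition lambda2 (eps : R) (U : state) : R :=
  let (u, rho) := U in u + sqrt (eps * Derive p rho * rho).

Definition shock (eps s : R) (Ul Ur : state) : Prop :=
  Ul <> Ur /\
  s * (fst Ur - fst Ul) = flux_u eps Ur - flux_u eps Ul /\
  s * (snd Ur - snd Ul) = flux_rho Ur - flux_rho Ul.

Definition lax_1_shock (eps : R) (Ul Ur : state) : Prop :=
  exists s : R,
    shock eps s Ul Ur /\
    s < lambda1 eps Ul /\
    lambda1 eps Ur < s < lambda2 eps Ur.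

Definition lax_2_shock (eps : R) (Ul Ur : state) : Prop :=
  exists s : R,
    shock eps s Ul Ur /\
    lambda2 eps Ur < s /\
    lambda1 eps Ul < s < lambda2 eps Ul.

(* Main.v *)
Require Import Defs.
From Stdlib Require Import Reals Ranalysis5 Lra.
From Coquelicot Require Import Coquelicot.
Open Scope R_scope.

(** Since [p'(x) = x exp x], the quotient [2 (p b - p a) / (b^2 - a^2)] is the
    mean of [exp] over [[a, b]] for the measure [d(x^2)]; so it lies strictly
    between [exp a] and [exp b] ([p_increment_bounds]).  Everything
    specific to this pressure law enters through that estimate.

    Eliminating the speed from the Rankine-Hugoniot conditions leaves one
    equation for the slope [k] of the jump of [u] against that of [rho]: [k^2]
    is [eps] times the mean above ([shock_slope]).  Since the characteristic
    speeds are [u -/+ rho sqrt (eps exp rho)], the bounds on the mean decide the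
    Lax inequalities: a 1-shock is exactly a jump with increasing [rho] and
    [u] falling by [sqrt eps * shock_strength a b] ([lax_1_shock_iff]).  The
    reflection [x -> -x] exchanges the two families, which gives 2-shocks
    ([lax_2_shock_iff]).

    The intermediate density [rho] is therefore a solution above [rhol] and
    [rhor] of
      [sqrt eps * (shock_strength rhol rho + shock_strength rhor rho) = ul - ur].
    The left-hand side is continuous, strictly increasing and unbounded in [rho],
    so there is exactly one solution provided that the left-hand side is below
    [ul - ur] at [rho = Rmax rhol rhor].  For small [eps] it is, because
    [ul - ur > 0]. *)

(** * The pressure law *)

Lemma is_derive_RInt_continuous (f : R -> R) (a x : R) :
  (forall y, continuous f y) -> is_derive (fun y => RInt f a y) x (f x).
Proof.
intros Hf.
apply (is_derive_RInt f (fun y => RInt f a y) a x); [|apply Hf].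
apply filter_forall; intros y.
apply (RInt_correct f a y), (ex_RInt_continuous f); intros z _; apply Hf.
Qed.

Lemma Derive_q (x : R) : Derive q x = x ^ 2 * exp x.
Proof.
apply is_derive_unique.
apply (is_derive_RInt_continuous (fun xi => xi ^ 2 * exp xi)).
intros y; apply (ex_derive_continuous (fun xi => xi ^ 2 * exp xi)).
auto_derive; auto.
Qed.

Lemma is_derive_p (x : R) : is_derive p x (x * exp x).
Proof.
apply (is_derive_ext (fun y => RInt (fun xi => xi * exp xi) 0 y)).
- intros y; apply RInt_ext; intros xi _; rewrite Derive_q.
  change (@eq R (xi * exp xi) (xi ^ 2 * exp xi / xi)).
  destruct (Req_dec xi 0) as [-> | Hxi].
  + unfold Rdiv; ring.
  + now field.
- apply (is_derive_RInt_continuous (fun xi => xi * exp xi)).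
  intros y; apply (ex_derive_continuous (fun xi => xi * exp xi)).
  auto_derive; auto.
Qed.

(** The mean value theorem for [x -> 2 p x - C x^2], whose derivative
    [2 x (exp x - C)] has a constant sign on [(a, b)] when [C] is [exp a] or
    [exp b]. *)
Lemma p_increment_bounds (a b : R) : 0 < a -> a < b ->
  exp a * (b ^ 2 - a ^ 2) < 2 * (p b - p a) < exp b * (b ^ 2 - a ^ 2).
Proof.
intros Ha Hab.
assert (Hmvt : forall C, exists c, a < c < b /\
  2 * (p b - p a) - C * (b ^ 2 - a ^ 2) = 2 * c * (exp c - C) * (b - a)).
{ intros C.
  destruct (MVT_cor2 (fun x => 2 * p x - C * x ^ 2)
              (fun x => 2 * x * (exp x - C)) a b Hab) as [c [Hc Hcab]].
  - intros c _; apply is_derive_Reals.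
    auto_derive.
    + now exists (c * exp c); apply is_derive_p.
    + replace (Derive (fun x : R => p x) c) with (c * exp c)
        by (symmetry; apply is_derive_unique, is_derive_p).
      ring.
  - exists c; split; [exact Hcab | rewrite <- Hc; ring]. }
split.
- destruct (Hmvt (exp a)) as [c [[Hac Hcb] Hc]].
  assert (exp a < exp c) by now apply exp_increasing.
  assert (0 < 2 * c * (exp c - exp a) * (b - a))
    by (repeat apply Rmult_lt_0_compat; lra).
  lra.
- destruct (Hmvt (exp b)) as [c [[Hac Hcb] Hc]].
  assert (exp c < exp b) by now apply exp_increasing.
  assert (0 < 2 * c * (exp b - exp c) * (b - a))
    by (repeat apply Rmult_lt_0_compat; lra).
  nra.
Qed.

Lemma p_increasing (a b : R) : 0 < a -> a < b -> p a < p b.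
Proof.
intros Ha Hab.
destruct (p_increment_bounds a b Ha Hab) as [H _].
assert (0 < exp a * (b ^ 2 - a ^ 2))
  by (apply Rmult_lt_0_compat; [apply exp_pos | nra]).
lra.
Qed.

(** * The strength of a shock *)

(** The modulus of the velocity jump between the densities [a] and [b] at
    [eps = 1], as the Rankine-Hugoniot conditions determine it. *)
Definition shock_strength (a b : R) : R :=
  sqrt (2 * ((b - a) / (b + a) * (p b - p a))).

Lemma shock_strength_sqr (a b : R) : 0 < a -> a < b ->
  shock_strength a b ^ 2 * (b + a) = 2 * (b - a) * (p b - p a).
Proof.
intros Ha Hab.
assert (Hp := p_increasing a b Ha Hab).
unfold shock_strength; rewrite pow2_sqrt.
- field; lra.
- apply Rmult_le_pos; [lra|].
  apply Rmult_le_pos; [|lra].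
  apply Rlt_le, Rdiv_lt_0_compat; lra.
Qed.

Lemma shock_strength_pos (a b : R) : 0 < a -> a < b -> 0 < shock_strength a b.
Proof.
intros Ha Hab.
assert (Hp := p_increasing a b Ha Hab).
apply sqrt_lt_R0.
apply Rmult_lt_0_compat; [lra|].
apply Rmult_lt_0_compat; [|lra].
apply Rdiv_lt_0_compat; lra.
Qed.

(** Both factors [(b - a) / (b + a)] and [p b - p a] increase with [b]. *)
Lemma shock_strength_increasing (a b c : R) :
  0 < a -> a <= b -> b < c -> shock_strength a b < shock_strength a c.
Proof.
intros Ha Hab Hbc.
assert (Hp : p a <= p b).
{ destruct (Rle_lt_or_eq_dec _ _ Hab) as [Hlt | <-]; [|lra].
  now apply Rlt_le, p_increasing. }
assert (Hpc : p b < p c) by (apply p_increasing; lra).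
assert (Hr : 0 <= (b - a) / (b + a)) by (apply Rdiv_le_0_compat; lra).
assert (Hrc : (b - a) / (b + a) < (c - a) / (c + a)).
{ apply Rlt_div_l; [lra|].
  replace ((c - a) / (c + a) * (b + a)) with ((c - a) * (b + a) / (c + a))
    by (field; lra).
  apply Rlt_div_r; [lra | nra]. }
apply sqrt_lt_1_alt; split.
- apply Rmult_le_pos; [lra | apply Rmult_le_pos; lra].
- apply Rmult_lt_compat_l; [lra|].
  apply Rmult_le_0_lt_compat; lra.
Qed.

(** The square of [shock_strength a b / (b - a)] is the mean of [exp] over
    [[a, b]] for [d(x^2)], hence at least [exp a > 1].  The linear growth makes
    the strength unbounded in [b]. *)
Lemma shock_strength_ge (a b : R) : 0 < a -> a < b -> b - a <= shock_strength a b.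
Proof.
intros Ha Hab.
assert (Hg := shock_strength_sqr a b Ha Hab).
assert (Hg0 := shock_strength_pos a b Ha Hab).
destruct (p_increment_bounds a b Ha Hab) as [Hp _].
assert (Hexp : 1 < exp a) by (rewrite <- exp_0; now apply exp_increasing).
assert (Hd : 0 < b ^ 2 - a ^ 2) by nra.
assert (Hp' : (b - a) * (b + a) < 2 * (p b - p a)) by nra.
apply Rsqr_incr_0; [|lra|lra].
unfold Rsqr; apply Rmult_le_reg_r with (b + a); [lra|].
nra.
Qed.

Lemma shock_strength_continuous (a b : R) :
  0 < a -> a <= b -> continuous (shock_strength a) b.
Proof.
intros Ha Hab.
apply (continuous_comp
         (fun b => 2 * ((b - a) / (b + a) * (p b - p a))) sqrt).
- apply (ex_derive_continuous (V := R_NormedModule)).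
  auto_derive; split; [lra|].
  split; [exists (b * exp b); apply is_derive_p | auto].
- apply continuous_sqrt.
Qed.

(** * Lax shocks *)

Lemma sqrt_characteristic (eps rho : R) : 0 < eps -> 0 < rho ->
  sqrt (eps * Derive p rho * rho) = rho * sqrt (eps * exp rho).
Proof.
intros He Hr.
rewrite (is_derive_unique p rho _ (is_derive_p rho)).
replace (eps * (rho * exp rho) * rho) with (rho ^ 2 * (eps * exp rho)) by ring.
rewrite sqrt_mult_alt by nra.
now rewrite sqrt_pow2 by lra.
Qed.

(** The slope [k] of the jump is the natural unknown: the density equation gives
    the speed linearly in [k], and the velocity equation then prescribes
    [k^2]. *)
Lemma shock_slope (eps s v a u b : R) : 0 < a ->
  shock eps s (v, a) (u, b) <->
  a <> b /\
  exists k, u = v + k * (b - a) /\ s = v + b * k /\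
            k ^ 2 * (b ^ 2 - a ^ 2) = 2 * eps * (p b - p a).
Proof.
intros Ha; unfold shock, flux_u, flux_rho; simpl fst; simpl snd; split.
- intros [Hne [H1 H2]].
  assert (Hab : a <> b).
  { intros <-; apply Hne; f_equal.
    apply Rmult_eq_reg_l with a; lra. }
  split; [exact Hab|].
  pose (k := (u - v) / (b - a)).
  assert (Hu : u = v + k * (b - a)) by (unfold k; field; lra).
  assert (Hs : s = v + b * k).
  { apply Rmult_eq_reg_r with (b - a); [|lra].
    rewrite H2, Hu; ring. }
  exists k; split; [exact Hu|]; split; [exact Hs|].
  rewrite Hs, Hu in H1; nra.
- intros [Hab [k [-> [-> Hk]]]]; split; [|split].
  + now intros [= _ E].
  + nra.
  + ring.
Qed.

(** [w^2 / eps] is the mean of [exp] over [[a, b]] for [d(x^2)]. *)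
Lemma slope_bounds (eps w a b : R) : 0 < eps -> 0 < w -> 0 < a -> a < b ->
  w ^ 2 * (b ^ 2 - a ^ 2) = 2 * eps * (p b - p a) ->
  sqrt (eps * exp a) < w < sqrt (eps * exp b).
Proof.
intros He Hw Ha Hab Hk.
destruct (p_increment_bounds a b Ha Hab) as [Hl Hr].
assert (Hd : 0 < b ^ 2 - a ^ 2) by nra.
rewrite <- (sqrt_pow2 w) by lra.
assert (0 < exp a) by apply exp_pos.
split; apply sqrt_lt_1_alt; split; try nra;
  apply Rmult_lt_reg_r with (b ^ 2 - a ^ 2); try exact Hd; nra.
Qed.

(** A Lax 1-shock has [k < 0], and [s < lambda1] on the left says
    [b |k| > a sqrt (eps exp a)]; for [b < a] this contradicts the upper
    bound [|k| < sqrt (eps exp a)].  For [a < b] the slope bounds imply all the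
    Lax inequalities. *)
Lemma lax_1_shock_iff (eps v a u b : R) : 0 < eps -> 0 < a -> 0 < b ->
  lax_1_shock eps (v, a) (u, b) <->
  a < b /\ u = v - sqrt eps * shock_strength a b.
Proof.
intros He Ha Hb.
assert (Hse : 0 < sqrt eps) by now apply sqrt_lt_R0.
assert (Hse2 : sqrt eps ^ 2 = eps) by (apply pow2_sqrt; lra).
unfold lax_1_shock, lambda1, lambda2.
rewrite !sqrt_characteristic by assumption.
assert (Hca : 0 < sqrt (eps * exp a))
  by (apply sqrt_lt_R0, Rmult_lt_0_compat; [|apply exp_pos]; assumption).
assert (Hcb : 0 < sqrt (eps * exp b))
  by (apply sqrt_lt_R0, Rmult_lt_0_compat; [|apply exp_pos]; assumption).
split.
- intros [s [Hs [L1 [L2 L3]]]].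
  apply shock_slope in Hs; [|assumption].
  destruct Hs as [Hne [k [-> [-> Hk]]]].
  assert (Hbk : b * - k > a * sqrt (eps * exp a)) by lra.
  assert (Hk0 : 0 < - k).
  { apply Rmult_lt_reg_l with b; [assumption|].
    assert (0 < a * sqrt (eps * exp a)) by now apply Rmult_lt_0_compat.
    lra. }
  destruct (Rtotal_order a b) as [Hab | [Hab | Hab]]; [|contradiction|].
  + split; [exact Hab|].
    assert (Hg := shock_strength_sqr a b Ha Hab).
    assert (Hg0 := shock_strength_pos a b Ha Hab).
    enough (- k * (b - a) = sqrt eps * shock_strength a b) by lra.
    apply Rsqr_inj.
    * apply Rmult_le_pos; lra.
    * apply Rmult_le_pos; lra.
    * apply Rmult_eq_reg_r with (b + a); [|lra].
      transitivity (k ^ 2 * (b ^ 2 - a ^ 2) * (b - a)); [unfold Rsqr; ring|].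
      transitivity (sqrt eps ^ 2 * (shock_strength a b ^ 2 * (b + a)));
        [|unfold Rsqr; ring].
      rewrite Hk, Hg, Hse2; ring.
  + exfalso.
    destruct (slope_bounds eps (- k) b a He Hk0 Hb Hab) as [_ Hlt]; [lra|].
    nra.
- intros [Hab ->].
  assert (Hg := shock_strength_sqr a b Ha Hab).
  assert (Hg0 := shock_strength_pos a b Ha Hab).
  pose (w := sqrt eps * shock_strength a b / (b - a)).
  assert (Hw : 0 < w)
    by (apply Rdiv_lt_0_compat; [apply Rmult_lt_0_compat|]; lra).
  assert (Hwg : sqrt eps * shock_strength a b = w * (b - a))
    by (unfold w; field; lra).
  assert (Hw2 : w ^ 2 * (b ^ 2 - a ^ 2) = 2 * eps * (p b - p a)).
  { apply Rmult_eq_reg_r with (b - a); [|lra].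
    transitivity ((w * (b - a)) ^ 2 * (b + a)); [ring|].
    rewrite <- Hwg.
    transitivity (sqrt eps ^ 2 * (shock_strength a b ^ 2 * (b + a))); [ring|].
    rewrite Hg, Hse2; ring. }
  destruct (slope_bounds eps w a b He Hw Ha Hab Hw2) as [Hl Hr].
  rewrite Hwg.
  exists (v - b * w); split; [|split; [nra | split; nra]].
  apply shock_slope; [assumption|].
  split; [lra|].
  exists (- w); repeat split; [ring | ring | rewrite <- Hw2; ring].
Qed.

(** Invariance under [(x, u, s) -> (-x, -u, -s)]. *)
Lemma lax_2_shock_reflect (eps v a u b : R) :
  lax_2_shock eps (v, a) (u, b) <-> lax_1_shock eps (- u, b) (- v, a).
Proof.
unfold lax_1_shock, lax_2_shock, shock, lambda1, lambda2, flux_u, flux_rho.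
simpl fst; simpl snd.
split; intros [s [[Hne [H1 H2]] HL]]; exists (- s);
  (split; [split; [|split; lra] | lra]);
  intros [= E1 E2]; apply Hne; f_equal; lra.
Qed.

Lemma lax_2_shock_iff (eps v a u b : R) : 0 < eps -> 0 < a -> 0 < b ->
  lax_2_shock eps (v, a) (u, b) <->
  b < a /\ v = u + sqrt eps * shock_strength b a.
Proof.
intros He Ha Hb.
rewrite lax_2_shock_reflect, lax_1_shock_iff by assumption.
split; intros [H1 H2]; split; lra.
Qed.

(** * The Riemann problem *)

(** The intermediate value theorem on [[M, M + d / e]] with [M = Rmax a b]; at
    the right end each of the two strengths is at least [d / e]. *)
Lemma total_strength_attained (a b d e : R) : 0 < a -> 0 < b -> 0 < d -> 0 < e ->
  e * (shock_strength a (Rmax a b) + shock_strength b (Rmax a b)) < d ->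
  exists rho, a < rho /\ b < rho /\
    e * (shock_strength a rho + shock_strength b rho) = d.
Proof.
intros Ha Hb Hd He HM.
set (M := Rmax a b) in *.
assert (HaM : a <= M) by apply Rmax_l.
assert (HbM : b <= M) by apply Rmax_r.
assert (Hde : 0 < d / e) by now apply Rdiv_lt_0_compat.
destruct (IVT_interv
  (fun x => e * (shock_strength a x + shock_strength b x) - d)
  M (M + d / e)) as [z [[HMz _] Hz]].
- intros x [Hx _]; apply continuity_pt_filterlim.
  apply (continuous_minus
    (fun x => e * (shock_strength a x + shock_strength b x)) (fun _ => d));
    [|apply continuous_const].
  apply (continuous_scal_r e
    (fun x => shock_strength a x + shock_strength b x)).
  apply (continuous_plus (shock_strength a) (shock_strength b));
    apply shock_strength_continuous; lra.
- lra.
- lra.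
- assert (Hga := shock_strength_ge a (M + d / e) Ha ltac:(lra)).
  assert (Hgb := shock_strength_ge b (M + d / e) Hb ltac:(lra)).
  assert (Hed : e * (d / e) = d) by (field; lra).
  nra.
- assert (M <> z) by (intros <-; lra).
  exists z; repeat split; lra.
Qed.

Theorem theorem3p1 (ul ur rhol rhor : R)
  (hrhol : 0 < rhol) (hrhor : 0 < rhor) (hu : ur < ul) :
  exists eta : R, 0 < eta /\
    forall eps : R, 0 < eps < eta ->
      exists! U : state,
        admissible U /\
        lax_1_shock eps (ul, rhol) U /\
        lax_2_shock eps U (ur, rhor).
Proof.
set (M := Rmax rhol rhor).
set (G := shock_strength rhol M + shock_strength rhor M).
assert (HG : 0 <= G)
  by (apply Rplus_le_le_0_compat; apply sqrt_pos).
assert (HdG : 0 < (ul - ur) / (G + 1)) by (apply Rdiv_lt_0_compat; lra).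
(* [G] may vanish (when [rhol = rhor]), hence [G + 1] in the threshold. *)
exists (((ul - ur) / (G + 1)) ^ 2); split; [nra|].
intros eps [He Heta].
assert (Hse : 0 < sqrt eps) by now apply sqrt_lt_R0.
assert (Hsmall : sqrt eps * G < ul - ur).
{ assert (Hs : sqrt eps < (ul - ur) / (G + 1)).
  { rewrite <- (sqrt_pow2 ((ul - ur) / (G + 1))) by lra.
    apply sqrt_lt_1_alt; lra. }
  apply Rlt_div_r in Hs; lra. }
destruct (total_strength_attained rhol rhor (ul - ur) (sqrt eps))
  as [rho [Hl [Hr Hrho]]]; try assumption; [lra|].
exists (ul - sqrt eps * shock_strength rhol rho, rho); split.
- split; [unfold admissible; simpl; lra|].
  rewrite lax_1_shock_iff, lax_2_shock_iff by lra.
  repeat split; lra.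
- intros [u r] [Hadm [H1 H2]].
  unfold admissible in Hadm; simpl in Hadm.
  apply lax_1_shock_iff in H1; [|assumption..].
  apply lax_2_shock_iff in H2; [|assumption..].
  destruct H1 as [Hlr ->]; destruct H2 as [Hrr Hsum].
  enough (rho = r) as -> by reflexivity.
  destruct (Rtotal_order rho r) as [Hlt | [Heq | Hlt]]; [|exact Heq|]; exfalso.
  + assert (Ha := shock_strength_increasing rhol rho r hrhol ltac:(lra) Hlt).
    assert (Hb := shock_strength_increasing rhor rho r hrhor ltac:(lra) Hlt).
    nra.
  + assert (Ha := shock_strength_increasing rhol r rho hrhol ltac:(lra) Hlt).
    assert (Hb := shock_strength_increasing rhor r rho hrhor ltac:(lra) Hlt).
    nra.
Qed.
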